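(* Let $\mathbb W$, $C$ and $G$ be as in the context, and suppose there exist $1\le i\le l$ with $k_i=1$ (i.e. the exponent $m_i$ occurs exactly once) and a prime $p\equiv 3\pmod 4$ dividing $m_i$. Then the natural short exact sequence $1\to\operatorname{Inn}(\mathbb W)\to\operatorname{Aut}(\mathbb W)\to\operatorname{Out}(\mathbb W)\to 1$ splits. More precisely, there is a subgroup $D\le C$ with $D\cap\langle\widehat{w_1}\rangle=1$ and $C=D\langle\widehat{w_1}\rangle$ such that $G$ normalises $D$, $DG$ is a complement of $\operatorname{Inn}(\mathbb W)$ in $\operatorname{Aut}(\mathbb W)$, and $\operatorname{Out}(\mathbb W)\cong D\rtimes G$.
   Context: Fix an integer $n\ge 3$, pairwise distinct odd integers $m_1,\dots,m_l\ge 3$ and positive integers $k_1,\dots,k_l$ with $k_1+\cdots+k_l=n-1$. Partition $\{2,\dots,n\}$ into consecutive blocks $A_1=\{2,\dots,k_1+1\}$, $A_2=\{k_1+2,\dots,k_1+k_2+1\}$, …, $A_l$ (of sizes $k_1,\dots,k_l$), and put $t_i=m_j$ for $i\in A_j$. The star group is $\mathbb W=\langle w_1,\dots,w_n\mid w_j^2=1\ (1\le j\le n),\ (w_1w_i)^{t_i}=1\ (2\le i\le n)\rangle$. For $2\le i\le n$ and $1\le k<t_i$ with $\gcd(k,t_i)=1$, $\theta_i^k$ is the automorphism of $\mathbb W$ with $\theta_i^k(w_j)=w_j$ for $j\ne i$ and $\theta_i^k(w_i)=w_1(w_1w_i)^k$. Let $C_i=\langle\theta_i^k : 1\le k<t_i,\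 \gcd(k,t_i)=1\rangle\cong \operatorname{U}_{t_i}$ and $C=C_2\times\cdots\times C_n\le\operatorname{Aut}(\mathbb W)$. $\widehat{w_1}$ is the inner automorphism $x\mapsto w_1xw_1$. $G$ is the group of graph automorphisms: the automorphisms $\tilde\alpha$ of $\mathbb W$ with $\tilde\alpha(w_1)=w_1$ and $\tilde\alpha(w_i)=w_{\alpha(i)}$ ($2\le i\le n$), where $\alpha$ ranges over permutations of $\{2,\dots,n\}$ with $\alpha(A_j)=A_j$ for all $j$. $\operatorname{Out}(\mathbb W)=\operatorname{Aut}(\mathbb W)/\operatorname{Inn}(\mathbb W)$. *)

(* Defs.v *)
From mathcomp Require Import all_boot.
Set Implicit Arguments. Unset Strict Implicit. Unset Printing Implicit Defensive.

Record grp := Grp {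
  gcar :> Type;
  gmul : gcar -> gcar -> gcar;
  gone : gcar;
  ginv : gcar -> gcar;
  gmulA : forall x y z, gmul x (gmul y z) = gmul (gmul x y) z;
  gmul1 : forall x, gmul gone x = x;
  gmulV : forall x, gmul (ginv x) x = gone
}.

Fixpoint gpow (H : grp) (x : H) (e : nat) : H :=
  if e is e'.+1 then gmul x (gpow x e') else gone H.

Definition ghom (H K : grp) (f : H -> K) : Prop :=
  forall x y, f (gmul x y) = gmul (f x) (f y).

(** Block structure: A_j = {2 + k_0+..+k_{j-1}, ..., 1 + k_0+..+k_j}
    (0-indexed blocks j < size k). *)
Definition inBlock (k : seq nat) (j i : nat) : bool :=
  (2 + \sum_(r < j) nth 0 k r <= i) && (i < 2 + \sum_(r < j.+1) nth 0 k r).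

(** t_i = m_j for i in A_j. *)
Definition tval (m k : seq nat) (i : nat) : nat :=
  \sum_(j < size m | inBlock k j i) nth 0 m j.

Definition star_rel (n : nat) (m k : seq nat) (H : grp) (h : nat -> H) : Prop :=
  (forall j, 1 <= j <= n -> gmul (h j) (h j) = gone H) /\
  (forall i, 2 <= i <= n -> gpow (gmul (h 1) (h i)) (tval m k i) = gone H).

(** (W, w) is a group presented by the star-group presentation:
    the w_j satisfy the relations and (W,w) has the universal property. *)
Definition is_star_group (n : nat) (m k : seq nat) (W : grp) (w : nat -> W) : Prop :=
  star_rel n m k w /\
  (forall (H : grp) (h : nat -> H), star_rel n m k h ->
     exists f : W -> H, ghom f /\ forall j, 1 <= j <= n -> f (w j) = h j) /\
  (forall (H : grp) (f g : W -> H), ghom f -> ghom g ->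
     (forall j, 1 <= j <= n -> f (w j) = g (w j)) -> forall x, f x = g x).

Definition feq (W : grp) (f g : W -> W) : Prop := forall x, f x = g x.

Definition is_aut (W : grp) (f : W -> W) : Prop :=
  ghom f /\ exists g : W -> W, (forall x, g (f x) = x) /\ (forall x, f (g x) = x).

Definition is_inn (W : grp) (f : W -> W) : Prop :=
  exists a : W, feq f (fun x => gmul (gmul a x) (ginv a)).

Definition aut_subgroup (W : grp) (P : (W -> W) -> Prop) : Prop :=
  (forall f, P f -> is_aut f) /\
  (forall f g, P f -> feq f g -> P g) /\
  P id /\
  (forall f g, P f -> P g -> P (fun x => f (g x))) /\
  (forall f g, P f -> (forall x, g (f x) = x) -> (forall x, f (g x) = x) -> P g).

Definition aut_gen (W : grp) (S : (W -> W) -> Prop) (f : W -> W) : Prop :=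
  forall P, aut_subgroup P -> (forall g, S g -> P g) -> P f.

Definition hat_w1 (W : grp) (w : nat -> W) : W -> W :=
  fun x => gmul (gmul (w 1) x) (w 1).

Definition theta_gen (n : nat) (m k : seq nat) (W : grp) (w : nat -> W)
    (f : W -> W) : Prop :=
  exists i e, (2 <= i <= n) /\ (1 <= e < tval m k i) /\ coprime e (tval m k i) /\
    is_aut f /\
    (forall j, 1 <= j <= n -> j != i -> f (w j) = w j) /\
    f (w i) = gmul (w 1) (gpow (gmul (w 1) (w i)) e).

Definition Cgrp (n : nat) (m k : seq nat) (W : grp) (w : nat -> W) :=
  aut_gen (theta_gen n m k w).

Definition W1grp (W : grp) (w : nat -> W) := aut_gen (fun f => feq f (hat_w1 w)).

Definition block_perm (n : nat) (k : seq nat) (alpha : nat -> nat) : Prop :=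
  (forall i, 2 <= i <= n -> 2 <= alpha i <= n) /\
  (forall i j, 2 <= i <= n -> 2 <= j <= n -> alpha i = alpha j -> i = j) /\
  (forall i j, 2 <= i <= n -> inBlock k j (alpha i) = inBlock k j i).

Definition Ggrp (n : nat) (k : seq nat) (W : grp) (w : nat -> W) (f : W -> W) : Prop :=
  is_aut f /\ exists alpha, block_perm n k alpha /\ f (w 1) = w 1 /\
    (forall i, 2 <= i <= n -> f (w i) = w (alpha i)).

(* Main.v *)
(* With b_i = w_1 w_i, the star group is the semidirect product of the free
   product of the cyclic groups <b_i> of odd order t_i by <w_1>, where w_1 acts
   on reduced words by inverting every letter.  Reduced words are unique because
   the group acts on them.  Hence an involution gives a palindromic reduced word
   and is conjugate to w_1, the centraliser of w_1 is <w_1>, and an element of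
   odd order inverted by w_1 is a power of some b_j.  After an inner
   automorphism, any automorphism therefore fixes w_1 and sends each b_i to a
   power of some b_{alpha i}, so it lies in CG.

   An element of C is given by exponents e_i prime to t_i, and conjugation by w_1
   has all exponents -1.  If i0 is the index of the exponent that occurs once, D
   consists of the automorphisms for which e_{i0} is a square mod p; since -1 is
   not a square mod p, D is a complement of the conjugation by w_1 in C, and G
   normalises D because it fixes i0. *)
Require Import Defs.
From Stdlib Require Import FunctionalExtensionality ProofIrrelevance.
From mathcomp Require Import all_boot zify.
Set Implicit Arguments. Unset Strict Implicit. Unset Printing Implicit Defensive.

Local Infix "**" := gmul (at level 40, left associativity).

(** * Elementary identities for groups and homomorphisms *)

Section GroupLaws.
Variable H : grp.
Implicit Types x y z : H.

Lemma gmulK x y : ginv x ** (x ** y) = y.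
Proof. by rewrite gmulA gmulV gmul1. Qed.

Lemma gmulI x y z : x ** y = x ** z -> y = z.
Proof. by move=> E; rewrite -(gmulK x y) E gmulK. Qed.

Lemma gmulx1 x : x ** gone H = x.
Proof. by apply: (@gmulI (ginv x)); rewrite gmulA gmulV gmul1. Qed.

Lemma gmulxV x : x ** ginv x = gone H.
Proof. by apply: (@gmulI (ginv x)); rewrite gmulK gmulx1. Qed.

Lemma gmulVK x y : x ** (ginv x ** y) = y.
Proof. by rewrite gmulA gmulxV gmul1. Qed.

Lemma gmulIr x y z : y ** x = z ** x -> y = z.
Proof. by move=> E; rewrite -[y]gmulx1 -(gmulxV x) gmulA E -gmulA gmulxV gmulx1. Qed.

Lemma ginv_eq x y : x ** y = gone H -> ginv x = y.
Proof. by move=> E; apply: (@gmulI x); rewrite E gmulxV. Qed.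

Lemma ginvM x y : ginv (x ** y) = ginv y ** ginv x.
Proof. by apply: ginv_eq; rewrite -gmulA gmulVK gmulxV. Qed.

Lemma ginv1 : ginv (gone H) = gone H.
Proof. by apply: ginv_eq; rewrite gmul1. Qed.

Lemma gpowD x a b : gpow x (a + b) = gpow x a ** gpow x b.
Proof. by elim: a => [|a IH]; rewrite ?gmul1 // addSn /= IH gmulA. Qed.

Lemma gpowSr x a : gpow x a.+1 = gpow x a ** x.
Proof. by rewrite -addn1 gpowD /= gmulx1. Qed.

Lemma gpow1n a : gpow (gone H) a = gone H.
Proof. by elim: a => //= a ->; rewrite gmul1. Qed.

Lemma gpowM x a b : gpow x (a * b) = gpow (gpow x a) b.
Proof. by elim: b => [|b IH]; rewrite ?muln0 // mulnS gpowD IH. Qed.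

Lemma gpow_mod x t a : gpow x t = gone H -> gpow x (a %% t) = gpow x a.
Proof.
by move=> E; rewrite {2}(divn_eq a t) gpowD mulnC gpowM E gpow1n gmul1.
Qed.

Lemma gpow_eqmod x t a b :
  gpow x t = gone H -> a = b %[mod t] -> gpow x a = gpow x b.
Proof. by move=> E ab; rewrite -(gpow_mod a E) ab gpow_mod. Qed.

Lemma gpow_conj x y a : gpow (x ** y ** ginv x) a = x ** gpow y a ** ginv x.
Proof.
elim: a => [|a IH] /=; first by rewrite gmulx1 gmulxV.
by rewrite IH -!gmulA gmulK.
Qed.

Lemma gpow_inv x a : gpow (ginv x) a = ginv (gpow x a).
Proof.
elim: a => [|a IH]; first by rewrite ginv1.
by rewrite [in RHS]gpowSr ginvM -IH.
Qed.

End GroupLaws.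

Section Homomorphisms.
Variables (H K : grp) (f : H -> K).
Hypothesis fM : ghom f.

Lemma ghom1 : f (gone H) = gone K.
Proof. by apply: (@gmulI _ (f (gone H))); rewrite -fM gmul1 gmulx1. Qed.

Lemma ghomV x : f (ginv x) = ginv (f x).
Proof. by symmetry; apply: ginv_eq; rewrite -fM gmulxV ghom1. Qed.

Lemma ghomX x a : f (gpow x a) = gpow (f x) a.
Proof. by elim: a => [|a IH]; rewrite /= ?ghom1 // fM IH. Qed.

End Homomorphisms.

Lemma ghom_comp (H K L : grp) (f : K -> L) (g : H -> K) :
  ghom f -> ghom g -> ghom (fun x => f (g x)).
Proof. by move=> fM gM x y; rewrite gM fM. Qed.

Lemma ghom_cancel (H K : grp) (f : H -> K) (g : K -> H) :
  ghom f -> cancel f g -> cancel g f -> ghom g.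
Proof. by move=> fM fK gK x y; rewrite -{1}(gK x) -{1}(gK y) -fM fK. Qed.

(** * Targets for the universal property: permutation groups, subgroups, the group of order two *)

Section PermutationGroup.
Variable T : Type.

(** The inverse is stored as data, so that [ginv] needs no choice; the function determines it. *)
Record sym := Sym {
  sym_fun :> T -> T; sym_inv : T -> T;
  symK : cancel sym_fun sym_inv; sym_invK : cancel sym_inv sym_fun }.

Lemma sym_ext (p q : sym) : p =1 q -> p = q.
Proof.
case: p q => [f f' fK f'K] [g g' gK g'K] /= fg.
have {}fg : f = g by exact: functional_extensionality.
subst g; have E : f' = g'.
  by apply: functional_extensionality => x; rewrite -{1}(g'K x) fK.
by subst g'; congr Sym; exact: proof_irrelevance.
Qed.

Definition sym_mul (p q : sym) :=
  Sym (can_comp (symK p) (symK q)) (can_comp (sym_invK q) (sym_invK p)).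

Program Definition sym_grp : grp :=
  @Grp sym sym_mul (@Sym id id (frefl _) (frefl _)) (fun p => Sym (sym_invK p) (symK p)) _ _ _.
Next Obligation. exact: sym_ext. Qed.
Next Obligation. exact: sym_ext. Qed.
Next Obligation. by apply: sym_ext => y /=; rewrite symK. Qed.

End PermutationGroup.

Section Subgroup.
Variables (H : grp) (P : H -> Prop).
Hypotheses (P1 : P (gone H)) (PV : forall x, P x -> P (ginv x))
  (PM : forall x y, P x -> P y -> P (x ** y)).

Lemma sub_eq (x y : {z | P z}) : sval x = sval y -> x = y.
Proof.
by case: x y => [x px] [y py] /= E; subst y; congr exist; exact: proof_irrelevance.
Qed.

Definition sub_mul (x y : {z | P z}) : {z | P z} :=
  exist P _ (PM (svalP x) (svalP y)).

Program Definition sub_grp : grp :=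
  @Grp {z | P z} sub_mul (exist P _ P1) (fun x => exist P _ (PV (svalP x))) _ _ _.
Next Obligation. by apply: sub_eq; exact: gmulA. Qed.
Next Obligation. by apply: sub_eq; exact: gmul1. Qed.
Next Obligation. by apply: sub_eq; exact: gmulV. Qed.

End Subgroup.

Definition parity_grp : grp :=
  @Grp bool addb false id addbA addFb addbb.

(** * Reduced words and left multiplication by a letter *)

(* Words in the letters [(i, e)], standing for the power [b_i ^ e] of a
   generator of order [t i] of a free product of cyclic groups. *)
Section Words.
Variables (t : nat -> nat) (I : pred nat).

Definition diff_index (a b : nat * nat) := a.1 != b.1.
Definition letter (a : nat * nat) := I a.1 && (0 < a.2 < t a.1).
Definition reduced (x : seq (nat * nat)) := all letter x && sorted diff_index x.

Lemma reduced_cons a x :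
  reduced (a :: x) = [&& letter a, path diff_index a x & all letter x].
Proof. by rewrite /reduced /= andbA andbAC -andbA. Qed.

Lemma diff_index_sym : symmetric diff_index.
Proof. by move=> a b; rewrite /diff_index eq_sym. Qed.

Lemma reduced_rev x : reduced (rev x) = reduced x.
Proof.
rewrite /reduced all_rev rev_sorted; congr andb.
by case: x => //= a x; apply: eq_path => b c; exact: diff_index_sym.
Qed.

Definition inv_letter (a : nat * nat) := (a.1, t a.1 - a.2).
Definition inv_letters := map inv_letter.

Lemma letter_inv a : letter a -> letter (inv_letter a).
Proof. by case: a => i e; rewrite /letter /= => /andP [-> /=]; lia. Qed.

Lemma inv_letterK a : letter a -> inv_letter (inv_letter a) = a.
Proof.
by case: a => i e; rewrite /letter /inv_letter /= => /andP [_ ?]; congr pair; lia.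
Qed.

Lemma inv_lettersK x : reduced x -> inv_letters (inv_letters x) = x.
Proof.
case/andP=> + _; elim: x => //= a x IH /andP [la lx].
by rewrite inv_letterK ?IH.
Qed.

Lemma reduced_inv x : reduced x -> reduced (inv_letters x).
Proof.
case/andP=> xl xs; apply/andP; split.
  by rewrite all_map; apply: sub_all xl => a; exact: letter_inv.
by case: x xs {xl} => //= a x; rewrite path_map.
Qed.

(* Any reduced word equal to its own twisted reversal has odd length or is
   empty: two equal indices would meet in the middle. *)
Lemma reduced_palindrome (tau : nat * nat -> nat * nat) x :
  (forall a, (tau a).1 = a.1) -> sorted diff_index x -> x = rev (map tau x) ->
  x = [::] \/ exists y c, x = y ++ c :: rev (map tau y) /\ tau c = c.
Proof.
move=> tau1; have [N] := ubnP (size x); elim: N x => // N IH [|a x]; first by left.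
case/lastP: x => [|z b] sx sorted_x; first by move=> [E]; right; exists [::], a.
rewrite /= map_rcons rev_cons rev_rcons => -[ab] /eqP.
rewrite eqseq_rcons => /andP [/eqP zE /eqP ba].
have sz : sorted diff_index z.
  by move: sorted_x; rewrite /= rcons_path => /andP [/path_sorted].
have sizez : size z < N by move: sx; rewrite /= size_rcons; lia.
case: (IH z sizez sz zE) => [z0|[y [c [zy cc]]]].
  by move: sorted_x; rewrite z0 ab /= /diff_index tau1 eqxx.
right; exists (a :: y), c; split=> //.
by rewrite zy ba /= rev_cons -!cats1 -catA.
Qed.

Definition head_exp i (x : seq (nat * nat)) :=
  if x is (j, e) :: _ then if j == i then e else 0 else 0.
Definition tail_from i (x : seq (nat * nat)) :=
  if x is (j, e) :: y then if j == i then y else x else x.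
Definition put i e (x : seq (nat * nat)) := if e == 0 then x else (i, e) :: x.

(** Left multiplication by $b_i^e$ on normal forms: a word not starting with index [i] counts as
    starting with exponent 0, and a merged exponent 0 deletes the letter. *)
Definition lmul i e x := put i ((e + head_exp i x) %% t i) (tail_from i x).

Definition head_differs i (x : seq (nat * nat)) :=
  if x is a :: _ then a.1 != i else true.

(** Allowing exponent 0 in [put i e y] absorbs the case distinction on the first letter; [lmul] then
    only adds exponents modulo [t i]. *)
Lemma reduced_split i x : I i -> 0 < t i -> reduced x ->
  exists e y, [/\ e < t i, reduced y, head_differs i y & x = put i e y].
Proof.
move=> Ii t0; case: x => [|[j e] x] rx; first by exists 0, [::].
have [ji|ji] := eqVneq j i; last by exists 0, ((j, e) :: x).
subst j; exists e, x; move: rx; rewrite reduced_cons.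
case/and3P => /andP [_ /= /andP [e0 et]] px lx; split=> //.
- by rewrite /reduced lx (path_sorted px).
- by case: x px {lx} => //= a x /andP [+ _]; rewrite /diff_index /= eq_sym.
- by rewrite /put; case: eqP => //; lia.
Qed.

Lemma reduced_put i e y : I i -> e < t i -> reduced y -> head_differs i y ->
  reduced (put i e y).
Proof.
move=> Ii et ry hy; rewrite /put; have [//|e0] := eqVneq e 0.
rewrite reduced_cons /letter /= Ii et lt0n e0 /=.
case/andP: ry => -> ry; rewrite andbT.
by case: y ry hy => //= a y -> /=; rewrite andbT /diff_index /= eq_sym.
Qed.

Lemma lmul_put i a e y : e < t i -> head_differs i y ->
  lmul i a (put i e y) = put i ((a + e) %% t i) y.
Proof.
rewrite /lmul /put => et hy; have [->|e0] := eqVneq e 0; last by rewrite /= eqxx.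
by case: y hy => [|[j f] y] //= /negbTE ->.
Qed.

Lemma put_inv i e y : e < t i ->
  inv_letters (put i e y) = put i ((t i - e) %% t i) (inv_letters y).
Proof.
move=> et; rewrite /put; have [->|e0] := eqVneq e 0; first by rewrite subn0 modnn.
rewrite /= /inv_letter /= modn_small; last by lia.
by case: eqP => //; lia.
Qed.

Lemma head_differs_inv i y : head_differs i (inv_letters y) = head_differs i y.
Proof. by case: y. Qed.

Section OneIndex.
Variable i : nat.
Hypotheses (Ii : I i) (ti : 0 < t i).

Lemma reduced_lmul e x : reduced x -> reduced (lmul i e x).
Proof.
case/(reduced_split Ii ti) => f [y [ft ry hy ->]].
by rewrite lmul_put // reduced_put // ltn_mod.
Qed.

Lemma lmulD a e x : reduced x -> lmul i a (lmul i e x) = lmul i (a + e) x.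
Proof.
case/(reduced_split Ii ti) => f [y [ft ry hy ->]].
by rewrite !lmul_put ?ltn_mod // modnDmr addnA.
Qed.

Lemma lmul_mod e x : reduced x -> lmul i (e %% t i) x = lmul i e x.
Proof.
case/(reduced_split Ii ti) => f [y [ft ry hy ->]].
by rewrite !lmul_put // modnDml.
Qed.

Lemma lmul0 x : reduced x -> lmul i 0 x = x.
Proof.
case/(reduced_split Ii ti) => f [y [ft ry hy ->]].
by rewrite lmul_put // add0n modn_small.
Qed.

(** This is the relation $b_iw_1b_i=w_1$ for the action on words; it makes $w_1b_i$ act as an
    involution. *)
Lemma lmul_inv e x : reduced x ->
  lmul i e (inv_letters (lmul i e x)) = inv_letters x.
Proof.
case/(reduced_split Ii ti) => f [y [ft ry hy ->]].
rewrite lmul_put // !put_inv ?ltn_mod // lmul_put ?head_differs_inv ?ltn_mod //.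
congr put; rewrite modnDmr; apply/eqP; rewrite -(eqn_modDr (e + f)); apply/eqP.
have -> : e + (t i - (e + f) %% t i) + (e + f) = e + (t i + (e + f) %/ t i * t i).
  by rewrite {2}(divn_eq (e + f) (t i)); have := ltn_pmod (e + f) ti; lia.
have -> : t i - f + (e + f) = e + t i by lia.
by rewrite addnA addnC modnMDl.
Qed.

End OneIndex.

Lemma lmul_cons a x : reduced (a :: x) -> lmul a.1 a.2 x = a :: x.
Proof.
case: a => i e; rewrite reduced_cons => /and3P [/andP [/= Ii /andP [e0 et]] px _].
have hx : head_differs i x.
  by case: x px => //= b x /andP [+ _]; rewrite /diff_index /= eq_sym.
rewrite -{1}[x]/(put i 0 x) lmul_put // ?addn0; last by lia.
by rewrite modn_small // /put; case: eqP => //; lia.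
Qed.

End Words.

(** * The action of the star group on reduced words *)

Section WordPermutations.
Variables (t : nat -> nat) (I : pred nat).
Hypothesis t_gt0 : forall i, I i -> 0 < t i.

Definition rword := {x | reduced t I x}.

(** The guard [I i] lets every natural number index a permutation; indices outside [I] act
    trivially. *)
Lemma shift_subproof i e (x : rword) :
  reduced t I (if I i then lmul t i e (val x) else val x).
Proof.
by case: ifP => Ii; [apply: reduced_lmul; rewrite ?t_gt0 //|]; exact: (valP x).
Qed.

Definition shift i e (x : rword) : rword := exist (reduced t I) _ (shift_subproof i e x).
Definition flip (x : rword) : rword := exist (reduced t I) _ (reduced_inv (valP x)).

Lemma flipK : involutive flip.
Proof. by move=> x; apply: val_inj; exact: inv_lettersK (valP x). Qed.

Lemma shiftD i a e x : shift i a (shift i e x) = shift i (a + e) x.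
Proof.
apply: val_inj => /=; case Ii: (I i) => //.
by apply: (lmulD Ii (t_gt0 Ii)); exact: (valP x).
Qed.

Lemma shift0 i x : shift i 0 x = x.
Proof.
apply: val_inj => /=; case Ii: (I i) => //.
by apply: (lmul0 Ii (t_gt0 Ii)); exact: (valP x).
Qed.

Lemma shift_order i x : shift i (t i) x = x.
Proof.
rewrite -[RHS](shift0 i); apply: val_inj => /=; case Ii: (I i) => //.
rewrite -(lmul_mod Ii (t_gt0 Ii)) ?modnn //; exact: (valP x).
Qed.

Lemma shiftK i : cancel (shift i 1) (shift i (t i).-1).
Proof.
move=> x; rewrite shiftD addn1; have [ti|] := posnP (t i).
  rewrite ti; apply: val_inj => /=; case Ii: (I i) => //.
  by move: (t_gt0 Ii); rewrite ti.
by move/prednK => ->; exact: shift_order.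
Qed.

Lemma shift_invK i : cancel (shift i (t i).-1) (shift i 1).
Proof. by move=> x; rewrite shiftD addnC -shiftD shiftK. Qed.

Definition flip_sym := Sym flipK flipK.
Definition shift_sym i := Sym (@shiftK i) (@shift_invK i).

Lemma flip_shift i x : shift i 1 (flip (shift i 1 x)) = flip x.
Proof.
apply: val_inj => /=; case Ii: (I i) => //.
by apply: (lmul_inv Ii (t_gt0 Ii)); exact: (valP x).
Qed.

Lemma gpow_shift i e x : (@gpow (sym_grp rword) (shift_sym i) e : sym _) x = shift i e x.
Proof.
by elim: e => [|e IH]; rewrite ?shift0 //= IH shiftD.
Qed.

(** $w_1$ acts by inverting letters, and $w_i$ acts as $w_1b_i$. *)
Definition star_perm i : sym_grp rword :=
  if i == 1 then flip_sym else @gmul (sym_grp rword) flip_sym (shift_sym i).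

End WordPermutations.

(** * Consequences of the star presentation *)

Section StarGroup.
Variables (n : nat) (m k : seq nat) (W : grp) (w : nat -> W).
Hypothesis starW : is_star_group n m k w.
Hypothesis n_gt0 : 0 < n.

Local Notation t := (Defs.tval m k).
Local Notation I := [pred i | 2 <= i <= n].
Hypothesis t_odd : forall i, I i -> odd (t i) && (2 < t i).

Lemma exp_gt0 i : I i -> 0 < t i.
Proof. by move/t_odd; lia. Qed.

Definition rotation i := w 1 ** w i.

Lemma w1_square : w 1 ** w 1 = gone W.
Proof. by case: starW => [[-> //]]. Qed.

Lemma w_square i : I i -> w i ** w i = gone W.
Proof. by case: starW => [[H _] _] /= Ii; apply: H; lia. Qed.

Lemma w1K x : w 1 ** (w 1 ** x) = x.
Proof. by rewrite gmulA w1_square gmul1. Qed.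

Lemma w1V : ginv (w 1) = w 1.
Proof. exact/ginv_eq/w1_square. Qed.

Lemma w_rotation i : w i = w 1 ** rotation i.
Proof. by rewrite w1K. Qed.

Lemma rotation_order i : I i -> gpow (rotation i) (t i) = gone W.
Proof. by case: starW => [[_ H] _]; exact: H. Qed.

Lemma rotationV i e : I i -> ginv (gpow (rotation i) e) = w 1 ** gpow (rotation i) e ** w 1.
Proof.
move=> Ii; rewrite -{2}w1V -gpow_conj -gpow_inv; congr gpow; apply: ginv_eq.
by rewrite /rotation w1V -!gmulA w1K [w i ** _]gmulA w_square // gmul1 w1_square.
Qed.

Lemma rotation_inv_exp i e : I i -> e <= t i ->
  gpow (rotation i) (t i - e) = ginv (gpow (rotation i) e).
Proof.
move=> Ii et; symmetry; apply: ginv_eq.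
by rewrite -gpowD subnKC // rotation_order.
Qed.

Lemma star_hom_exists (H : grp) (h : nat -> H) : star_rel n m k h ->
  exists f : W -> H, ghom f /\ forall j, 1 <= j <= n -> f (w j) = h j.
Proof. by case: starW => [_ [H1 _]]; exact: H1. Qed.

Lemma star_hom_eq (H : grp) (f g : W -> H) : ghom f -> ghom g ->
  f (w 1) = g (w 1) -> (forall i, I i -> f (rotation i) = g (rotation i)) -> f =1 g.
Proof.
case: starW => [_ [_ U]] fM gM fg1 fg; apply: U => // -[//|[//|j]] jn.
by rewrite w_rotation fM gM fg1 fg.
Qed.

(** The universal property maps $\mathbb W$ into the subgroup cut out by [P]; followed by the
    inclusion, this map agrees with the identity on the generators, hence everywhere. *)
Lemma star_ind (P : W -> Prop) :
  P (gone W) -> (forall x, P x -> P (ginv x)) ->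
  (forall x y, P x -> P y -> P (x ** y)) ->
  P (w 1) -> (forall i, I i -> P (rotation i)) -> forall x, P x.
Proof.
move=> P1 PV PM Pw Pr.
have Pw' j : 1 <= j <= n -> P (w j).
  by case: j => [//|[//|j]] jn; rewrite w_rotation; apply: PM => //; exact: Pr.
(* Indices outside [1..n] carry no proof of membership and get the neutral element. *)
pose h j : sub_grp P1 PV PM :=
  if idP is ReflectT p then exist P (w j) (Pw' j p) else gone _.
have hE j : 1 <= j <= n -> sval (h j) = w j.
  by move=> jn; rewrite /h; case: {-}_ / idP.
have gpow_val (x : sub_grp P1 PV PM) e : sval (gpow x e) = gpow (sval x) e.
  by elim: e => //= e ->.
have h_rel : star_rel n m k h.
  split=> [j jn|i Ii]; apply: sub_eq.
    by rewrite /= hE //; case: starW => [[-> //]].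
  rewrite gpow_val /= !hE ?rotation_order //; lia.
have [f [fM fw]] := star_hom_exists h_rel.
have fE : (fun x => sval (f x)) =1 id.
  apply: star_hom_eq => //.
  - by move=> x y; rewrite fM.
  - by rewrite fw ?hE //; lia.
  - by move=> i /= Ii; rewrite fM /= !fw ?hE //; lia.
by move=> x; rewrite -(fE x); exact: svalP.
Qed.

(** Every $w_j$ goes to the nontrivial element; a rotation is a product of two generators, hence
    even. *)
Lemma parity_exists : exists d : W -> bool,
  [/\ forall x y, d (x ** y) = d x (+) d y, d (w 1) = true
    & forall i, I i -> d (rotation i) = false].
Proof.
have rel : @star_rel n m k parity_grp (fun=> true).
  by split=> // i _; exact: gpow1n.
have [d [dM dw]] := star_hom_exists rel.
exists d; split=> // [|i Ii]; first by rewrite dw //; lia.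
by rewrite dM !dw //=; move: Ii => /=; lia.
Qed.

(** * Normal forms: existence and uniqueness *)

Definition word (x : seq (nat * nat)) : W :=
  foldr (fun a y => gpow (rotation a.1) a.2 ** y) (gone W) x.

Definition w1_pow (eps : bool) := if eps then w 1 else gone W.

Local Notation is_reduced := (reduced t I).
Local Notation is_letter := (letter t I).

Lemma word_cat x y : word (x ++ y) = word x ** word y.
Proof. by elim: x => [|a x IH] /=; rewrite ?gmul1 // IH gmulA. Qed.

Lemma word_put i e y : word (put i e y) = gpow (rotation i) e ** word y.
Proof. by rewrite /put; case: eqP => [->|//]; rewrite gmul1. Qed.

Lemma word_lmul i e x : I i -> is_reduced x ->
  word (lmul t i e x) = gpow (rotation i) e ** word x.
Proof.
move=> Ii /(reduced_split Ii (exp_gt0 Ii)) [f [y [ft _ hy ->]]].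
by rewrite lmul_put // !word_put gpow_mod ?rotation_order // gpowD gmulA.
Qed.

(** Conjugation by $w_1$ inverts each letter in place, whereas inverting the word also reverses the
    order; this contrast yields the palindromes below. *)
Lemma word_w1 x : all is_letter x -> w 1 ** word x ** w 1 = word (inv_letters t x).
Proof.
elim: x => [|a x IH] /=; first by rewrite gmulx1 w1_square.
case/andP=> /andP [Ia /andP [_ at_]] /IH <-.
by rewrite rotation_inv_exp // ?rotationV //; [rewrite -!gmulA w1K | exact: ltnW].
Qed.

Lemma word_inv x : all is_letter x -> ginv (word x) = word (rev (inv_letters t x)).
Proof.
elim: x => [|a x IH] /=; first by rewrite ginv1.
case/andP=> /andP [Ia /andP [_ at_]] /IH E.
rewrite ginvM E rev_cons -cats1 word_cat /= gmulx1.
by rewrite rotation_inv_exp // ltnW.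
Qed.

Lemma word_surj a : exists x eps, is_reduced x /\ a = word x ** w1_pow eps.
Proof.
pose Q c := exists x eps, is_reduced x /\ c = word x ** w1_pow eps.
have Qw c : Q c -> Q (w 1 ** c).
  case=> x [eps [rx ->]]; exists (inv_letters t x), (~~ eps).
  split; first exact: reduced_inv.
  rewrite -word_w1; last by case/andP: rx.
  by case: eps => /=; rewrite -!gmulA ?gmulx1 ?w1_square ?gmulx1.
have Qr i e c : I i -> Q c -> Q (gpow (rotation i) e ** c).
  move=> Ii [x [eps [rx ->]]]; exists (lmul t i e x), eps.
  by split; [apply: reduced_lmul; rewrite ?exp_gt0 | rewrite word_lmul // gmulA].
(* An equivalence, quantified over [c], carries the induction through inverses. *)
suff QQ : forall c, Q (a ** c) <-> Q c.
  rewrite -[a]gmulx1; apply/(QQ (gone W)); exists [::], false.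
  by split=> //=; rewrite gmul1.
move: a; apply: star_ind => [c|x IH c|x y IHx IHy c|c|i Ii c].
- by rewrite gmul1.
- by rewrite -(IH (ginv x ** c)) gmulVK.
- by rewrite -gmulA IHx IHy.
- by split=> [/Qw|]; [rewrite w1K | exact: Qw].
- split=> [/(Qr i (t i).-1 _ Ii)|/(Qr i 1 _ Ii)]; last by rewrite /= gmulx1.
  rewrite gmulA -gpowSr prednK ?exp_gt0 // rotation_order //.
  by rewrite gmul1.
Qed.

(** $\mathbb W$ acts on reduced words through [star_perm], and [nf] takes the image of the empty
    word: the letters of a reduced word rebuild it from the right without merging. *)
Lemma normal_form_exists : exists nf : W -> seq (nat * nat),
  forall x eps, is_reduced x -> nf (word x ** w1_pow eps) = x.
Proof.
pose h := star_perm exp_gt0.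
have hI i : I i -> gmul (h 1) (h i) = shift_sym exp_gt0 i.
  case: i => [//|[//|i]] _; apply: sym_ext => x; exact: flipK.
have rel : star_rel n m k h.
  split=> [j _|i Ii].
    rewrite /h /star_perm; case: eqP => _; apply: sym_ext => x; first exact: flipK.
    by rewrite /= flip_shift flipK.
  by rewrite hI //; apply: sym_ext => x; rewrite gpow_shift shift_order.
have [f [fM fw]] := star_hom_exists rel.
pose e : rword t I := exist (reduced t I) [::] isT.
exists (fun a => val ((f a : sym _) e)) => x eps rx.
have -> : (f (word x ** w1_pow eps) : sym _) e = (f (word x) : sym _) e.
  rewrite fM /=; congr (sym_fun _ _); case: eps => /=; last by rewrite ghom1.
  by rewrite fw ?leqnn //=; apply: val_inj.
elim: x rx => [|a x IH] rx; first by rewrite ghom1.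
have [rx' Ia] : is_reduced x /\ I a.1.
  move: rx; rewrite reduced_cons => /and3P [/andP [Ia _] px lx].
  by rewrite /reduced lx (path_sorted px).
rewrite fM ghomX //= fM !fw; try (move: Ia => /=; lia).
by rewrite hI // gpow_shift /= ifT // IH // (lmul_cons rx).
Qed.

Lemma word_inj x y : is_reduced x -> is_reduced y -> word x = word y -> x = y.
Proof.
have [nf nfE] := normal_form_exists => rx ry E.
by rewrite -(nfE x false rx) -(nfE y false ry) E.
Qed.

(** * Powers of rotations *)

Lemma reduced_letter i e : I i -> 0 < e < t i -> is_reduced [:: (i, e)].
Proof. by rewrite /reduced /letter /= => -> ->. Qed.

Lemma reduced_put_nil i e : I i -> is_reduced (put i (e %% t i) [::]).
Proof. by move=> Ii; apply: reduced_put => //; rewrite ltn_mod exp_gt0. Qed.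

Lemma word_put_nil i e : I i -> word (put i (e %% t i) [::]) = gpow (rotation i) e.
Proof. by move=> Ii; rewrite word_put gmulx1 gpow_mod // rotation_order. Qed.

(** Both sides are words of at most one letter. The condition on [e] excludes the neutral element, a
    power of every rotation. *)
Lemma rotation_pow_eq i j e f : I i -> I j ->
  gpow (rotation i) e = gpow (rotation j) f -> ~~ (t i %| e) ->
  i = j /\ e = f %[mod t i].
Proof.
move=> Ii Ij; rewrite -(word_put_nil e Ii) -(word_put_nil f Ij).
move/word_inj => /(_ (reduced_put_nil e Ii) (reduced_put_nil f Ij)).
rewrite /put /dvdn => E /negbTE e0; move: E; rewrite e0.
by case: eqP => // _ [-> ->].
Qed.

Lemma rotation_pow_eq1 i e : I i -> gpow (rotation i) e = gone W -> t i %| e.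
Proof.
move=> Ii E; apply/negPn/negP => e0.
have [_] := @rotation_pow_eq i i e 0 Ii Ii E e0.
by move/eqP; rewrite mod0n -/(dvdn _ _) (negbTE e0).
Qed.

Lemma rotation_pow_inj i e f : I i ->
  gpow (rotation i) e = gpow (rotation i) f -> e = f %[mod t i].
Proof.
move=> Ii E; have [e0|e0] := boolP (t i %| e); last first.
  by have [] := @rotation_pow_eq i i e f Ii Ii E e0.
have /eqP -> : t i %| f.
  apply: rotation_pow_eq1 => //; rewrite -E -(divnK e0) mulnC gpowM.
  by rewrite rotation_order // gpow1n.
by apply/eqP.
Qed.

(** * The centraliser of $w_1$, involutions, and torsion inverted by $w_1$ *)

Lemma inv_letter_neq a : is_letter a -> inv_letter t a <> a.
Proof.
case: a => i e /andP [/= /t_odd] ti et [E].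
by move: ti; lia.
Qed.

Lemma w1_pow_comm eps : w 1 ** w1_pow eps = w1_pow eps ** w 1.
Proof. by case: eps => //=; rewrite gmulx1 gmul1. Qed.

Lemma word_w1l x : is_reduced x -> w 1 ** word x = word (inv_letters t x) ** w 1.
Proof.
by case/andP => lx _; rewrite -word_w1 // -!gmulA w1_square gmulx1.
Qed.

(** The reduced word must survive inverting its letters, but in odd order no letter is its own
    inverse, so the word is empty. *)
Lemma w1_centraliser a : a ** w 1 = w 1 ** a -> exists eps, a = w1_pow eps.
Proof.
have [x [eps [rx ->]]] := word_surj a; rewrite -gmulA -w1_pow_comm gmulA.
rewrite [w 1 ** (_ ** _)]gmulA => /gmulIr; rewrite word_w1l // => /gmulIr E.
have {E} := word_inj rx (reduced_inv rx) E.
case: x rx => [|a' x] rx; first by exists eps; rewrite gmul1.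
case=> /esym /inv_letter_neq [].
by move: rx; rewrite reduced_cons => /andP [].
Qed.

(* The order of [rotation i] is odd, so the power has a square root, and moving
   it across [w 1] inverts it. *)
Lemma rotation_w1_conj i e : I i -> exists d,
  gpow (rotation i) e ** w 1 = gpow (rotation i) d ** w 1 ** ginv (gpow (rotation i) d).
Proof.
(* [uphalf (t i)] is $(t_i+1)/2$, the inverse of 2 modulo $t_i$. *)
move=> Ii; exists (e * uphalf (t i)); rewrite rotationV // -!gmulA w1K gmulA.
rewrite -gpowD; congr (_ ** _).
apply: (@gpow_eqmod _ _ (t i)); first exact: rotation_order.
rewrite -mulnDr (_ : uphalf _ + _ = t i + 1); first by rewrite mulnDr muln1 modnMDl.
by have := t_odd Ii; lia.
Qed.

Lemma inverted_palindrome x : is_reduced x ->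
  w 1 ** word x ** w 1 = ginv (word x) -> x = rev (map id x).
Proof.
move=> rx; have [lx _] := andP rx; rewrite word_w1 // word_inv // => E.
have {}E : inv_letters t x = rev (inv_letters t x).
  by apply: word_inj; rewrite ?reduced_rev ?reduced_inv.
have:= congr1 (inv_letters t) E; rewrite [in RHS]/inv_letters map_rev.
by rewrite -[map _ (map _ _)]/(inv_letters t (inv_letters t x)) (inv_lettersK rx) map_id.
Qed.

(** With a factor $w_1$ the reduced word is a palindrome, and its two halves conjugate the middle
    letter times $w_1$. Without it the word is its own inverse, hence so is its middle letter, which
    is impossible. *)
Lemma involution_conj r : r ** r = gone W ->
  r = gone W \/ exists v, r = v ** w 1 ** ginv v.
Proof.
have [x [eps [rx ->]]] := word_surj r.
have [lx sx] := andP rx.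
case: eps => /= E.
- have {}E : x = rev (map id x).
    apply: inverted_palindrome => //; symmetry; apply: ginv_eq.
    by rewrite -E -!gmulA.
  case: (reduced_palindrome (fun=> erefl) sx E) => [->|[y [c [xy _]]]].
    by right; exists (gone W); rewrite ginv1 gmulx1.
  right; move: rx; rewrite xy map_id => rx; have {lx} := lx.
  rewrite xy map_id all_cat /= all_rev => /and3P [ly lc _].
  have [d dE] := rotation_w1_conj c.2 (proj1 (andP lc)).
  (* Moving $w_1$ across [word (rev y)] turns it into the inverse of [word y]; [d] absorbs the
     middle letter. *)
  exists (word y ** gpow (rotation c.1) d).
  have -> : word (y ++ c :: rev y) ** w 1 =
      word y ** (gpow (rotation c.1) c.2 ** w 1) ** ginv (word y).
    rewrite word_cat /= word_inv // /inv_letters -map_rev -/(inv_letters t _).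
    by rewrite -word_w1 ?all_rev // -!gmulA w1K.
  by rewrite dE ginvM !gmulA.
- left; rewrite !gmulx1 in E *.
  have {}E : x = rev (map (inv_letter t) x).
    apply: word_inj => //; first by rewrite reduced_rev reduced_inv.
    by rewrite -[map _ _]/(inv_letters t x) -word_inv // (ginv_eq E).
  case: (reduced_palindrome (tau := inv_letter t) (fun=> erefl) sx E)
    => [->|[y [c [xy cc]]]] //.
  case: (@inv_letter_neq c) => //.
  by move: lx; rewrite xy all_cat /= => /and3P [].
Qed.

(** At a junction the two letters [a] merge into [u], whose exponent is nonzero because [t a.1] is
    odd, so cancellation stops there. The induction only has to remember the first letter. *)
Lemma word_power a z N : is_reduced (a :: rcons z a) ->
  exists y, is_reduced (a :: y) /\ gpow (word (a :: rcons z a)) N.+1 = word (a :: y).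
Proof.
move=> rx; elim: N => [|N [y [ry E]]]; first by exists (rcons z a); rewrite [LHS]gmulx1.
pose u := (a.1, (a.2 + a.2) %% t a.1).
move: rx; rewrite reduced_cons rcons_path all_rcons.
case/and3P => /andP [Ia ea] /andP [pz za] /andP [_ lz].
move: ry; rewrite reduced_cons => /and3P [la py ly].
have lu : is_letter u.
  rewrite /letter /u Ia /= ltn_mod (exp_gt0 Ia) andbT.
  have := t_odd Ia; rewrite lt0n => ot; apply/negP => /eqP.
  have [lt2|ge2] := ltnP (a.2 + a.2) (t a.1); first by rewrite modn_small //; lia.
  rewrite -(subnK ge2) modnDr modn_small; lia.
exists (z ++ u :: y); split.
  have zu : diff_index (last a z) u by exact: za.
  rewrite reduced_cons la all_cat lz cat_path pz /= lu ly zu /=.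
  by case: y py {ly E} => //= b y ->.
rewrite -add1n gpowD E /= -cats1 !word_cat /= !gmulx1.
by rewrite gpow_mod ?rotation_order // gpowD !gmulA.
Qed.

(* If [w 1] inverts [b] then [b] is a palindrome; unless it is a single letter,
   consecutive factors of [b ^ N] merge only their end letters, so [b ^ N] never
   vanishes. *)
Lemma inverted_torsion b N : w 1 ** b ** w 1 = ginv b -> odd N -> gpow b N = gone W ->
  b = gone W \/ exists j e, [/\ I j, 0 < e < t j & b = gpow (rotation j) e].
Proof.
move=> bV oN bN; have [x [eps [rx bE]]] := word_surj b.
have [d [dM d1 dr]] := parity_exists.
have dX y e : d (gpow y e) = odd e && d y.
  elim: e => [|e IH] /=; last by rewrite dM IH; case: (odd e); case: (d y).
  by have := dM (gone W) (gone W); rewrite gmul1; case: (d _).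
have d0 : d (gone W) = false by exact: (dX _ 0).
have dword y : all is_letter y -> d (word y) = false.
  elim: y => [|a y IH] //= /andP [/andP [Ia _] /IH dy].
  by rewrite dM dX dr // dy andbF.
have [lx sx] := andP rx.
(* An odd power of an element of odd parity has odd parity, so it is nontrivial. *)
have eps0 : eps = false.
  have : d b = false by have := dX b N; rewrite bN oN d0.
  by rewrite bE dM dword //; case: eps bE => //=; rewrite d1.
move: bE; rewrite eps0 gmulx1 => bE; subst b.
have E := inverted_palindrome rx bV.
case: (reduced_palindrome (fun=> erefl) sx E) => [->|[y [c [xy _]]]]; first by left.
case: y xy => [|a y] xy.
  right; exists c.1, c.2; move: lx; rewrite xy /= andbT gmulx1.
  by case/andP.
have {}xy : x = a :: rcons (y ++ c :: rev y) a.
  by rewrite xy map_id /= rev_cons -!cats1 -catA.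
move: bN rx; rewrite xy -(prednK (odd_gt0 oN)) => bN rx.
have [v [rv vE]] := word_power N.-1 rx.
by have := @word_inj (a :: v) [::] rv isT; rewrite -vE bN => /(_ erefl).
Qed.

(** * Automorphisms fixing $w_1$ and raising each rotation to a power *)

Definition power_aut (f : W -> W) (e : nat -> nat) := [/\ ghom f, f (w 1) = w 1 &
  forall i, I i -> coprime (e i) (t i) /\ f (rotation i) = gpow (rotation i) (e i)].

Lemma power_aut_feq f g e : power_aut f e -> f =1 g -> power_aut g e.
Proof.
case=> fM f1 fr fg; split=> [x y||i Ii]; rewrite -?fg //; last exact: fr.
Qed.

Lemma power_aut_eq f g e e' : power_aut f e -> power_aut g e' ->
  (forall i, I i -> e i = e' i %[mod t i]) -> f =1 g.
Proof.
case=> fM f1 fr [gM g1 gr] ee; apply: star_hom_eq; rewrite ?f1 ?g1 // => i Ii.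
have [_ ->] := fr i Ii; have [_ ->] := gr i Ii.
by apply: (gpow_eqmod (rotation_order Ii)); exact: ee.
Qed.

Lemma power_aut_exp f e e' i : power_aut f e -> power_aut f e' -> I i ->
  e i = e' i %[mod t i].
Proof.
case=> _ _ fr [_ _ fr'] Ii; apply: rotation_pow_inj => //.
by have [_ <-] := fr i Ii; have [_ <-] := fr' i Ii.
Qed.

Lemma power_aut_id : power_aut id (fun=> 1).
Proof. by split=> // i Ii; rewrite coprime1n /= gmulx1. Qed.

Lemma power_aut_comp f g e e' : power_aut f e -> power_aut g e' ->
  power_aut (fun x => f (g x)) (fun i => e i * e' i).
Proof.
case=> fM f1 fr [gM g1 gr]; split=> [||i Ii]; first exact: ghom_comp.
  by rewrite g1.
have [ce fE] := fr i Ii; have [ce' gE] := gr i Ii.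
by rewrite coprimeMl ce ce' gE ghomX // fE gpowM.
Qed.

Lemma power_aut_hat : power_aut (hat_w1 w) (fun i => (t i).-1).
Proof.
rewrite /hat_w1; split=> [x y||i Ii].
- by rewrite -!gmulA w1K.
- by rewrite w1_square gmul1.
have ti := exp_gt0 Ii; split.
  by rewrite -{2}(prednK ti) coprimenS.
by rewrite -subn1 rotation_inv_exp // rotationV //= gmulx1.
Qed.

(** The elements $w_1b_i^{e_i}$ satisfy the relations: $w_1$ inverts $b_i^{e_i}$, and $t_i$ kills
    it. *)
Lemma power_aut_exists e : (forall i, I i -> coprime (e i) (t i)) ->
  exists f, power_aut f e.
Proof.
move=> ce; pose h j := if j == 1 then w 1 else w 1 ** gpow (rotation j) (e j).
have h1 i : I i -> h i = w 1 ** gpow (rotation i) (e i) by case: i => [|[]].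
have rel : star_rel n m k h.
  split=> [[//|[|i]] Ii|i Ii]; first exact: w1_square.
    by rewrite h1 // gmulA -rotationV // gmulV.
  by rewrite (h1 i) // w1K -gpowM mulnC gpowM rotation_order // gpow1n.
have [f [fM fw]] := star_hom_exists rel; exists f.
have f1 : f (w 1) = w 1 by rewrite fw.
split=> // i Ii; split; first exact: ce.
rewrite fM f1 fw; first by rewrite h1 // w1K.
by move: Ii => /=; lia.
Qed.

Lemma inverse_exp_coprime a b c : a * b = 1 %[mod c] -> coprime a c.
Proof.
move=> ab; suff : coprime (a * b) c by rewrite coprimeMl => /andP [].
by rewrite -coprime_modl ab coprime_modl coprime1n.
Qed.

Definition inverse_exp a c := (egcdn a c).1.

Lemma mul_inverse_exp a c : 1 < c -> coprime a c -> a * inverse_exp a c = 1 %[mod c].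
Proof.
move=> c1 ac; have a0 : 0 < a by case: a ac => //; rewrite /coprime gcd0n; lia.
rewrite /inverse_exp; case: (egcdnP c a0) => u v E _ /=.
by rewrite mulnC E (eqP ac) modnMDl.
Qed.

Lemma power_aut_inverse f e : power_aut f e ->
  exists g e', [/\ power_aut g e', cancel f g, cancel g f
    & forall i, I i -> e i * e' i = 1 %[mod t i]].
Proof.
move=> fe; pose e' i := inverse_exp (e i) (t i).
have ee' i : I i -> e i * e' i = 1 %[mod t i].
  move=> Ii; apply: mul_inverse_exp; first by move: (t_odd Ii); lia.
  by case: fe => _ _ /(_ i Ii) [].
have [g ge] : exists g, power_aut g e'.
  apply: power_aut_exists => i Ii; apply: (@inverse_exp_coprime _ (e i)).
  by rewrite mulnC ee'.
exists g, e'; split=> //.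
  apply: (power_aut_eq (power_aut_comp ge fe) power_aut_id) => i Ii.
  by rewrite mulnC ee'.
exact: (power_aut_eq (power_aut_comp fe ge) power_aut_id).
Qed.

Lemma power_aut_is_aut f e : power_aut f e -> is_aut f.
Proof.
move=> fe; split; first by case: fe.
by have [g [_ [_ fK gK _]]] := power_aut_inverse fe; exists g.
Qed.

(** The image of $b_i$ is inverted by $w_1=f(w_1)$ and killed by an odd power, so its normal form is
    a single letter, from which index and exponent are read off. *)
Lemma aut_rotation f : is_aut f -> f (w 1) = w 1 ->
  exists alpha e, forall i, I i ->
    I (alpha i) /\ f (rotation i) = gpow (rotation (alpha i)) (e i).
Proof.
case=> fM [f' [fK _]] f1.
have [nf nfE] := normal_form_exists.
exists (fun i => (head (0, 0) (nf (f (rotation i)))).1).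
exists (fun i => (head (0, 0) (nf (f (rotation i)))).2) => i Ii.
have [|||E|[j [e [Ij et E]]]] := @inverted_torsion (f (rotation i)) (t i).
- rewrite -f1 -!fM -(ghomV fM); congr f.
  by have := rotationV 1 Ii; rewrite /= gmulx1.
- by have /andP [] := t_odd Ii.
- by rewrite -ghomX // rotation_order // ghom1.
- have : gpow (rotation i) 1 = gone W.
    by rewrite /= gmulx1 -(fK (rotation i)) E -{1}(ghom1 fM) fK.
  by move/(rotation_pow_eq1 Ii); rewrite dvdn1; have := t_odd Ii; lia.
have -> : nf (f (rotation i)) = [:: (j, e)].
  rewrite E -(nfE [:: (j, e)] false) ?reduced_letter //=.
  by rewrite !gmulx1.
by [].
Qed.

(** Compare $b_i$ with $f'(f(b_i))$. For the divisibility, $t_{\alpha(i)}$ kills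
    $f'(b_{\alpha(i)})$, a power of $b_i$ with exponent prime to $t_i$. *)
Lemma aut_rotation_inverse f f' alpha e beta e' :
  ghom f' -> cancel f f' ->
  (forall i, I i -> I (alpha i) /\ f (rotation i) = gpow (rotation (alpha i)) (e i)) ->
  (forall i, I i -> I (beta i) /\ f' (rotation i) = gpow (rotation (beta i)) (e' i)) ->
  forall i, I i ->
  [/\ beta (alpha i) = i, e' (alpha i) * e i = 1 %[mod t i] & t i %| t (alpha i)].
Proof.
move=> f'M fK fE f'E i Ii; have [Iai fi] := fE i Ii; have [Ibi f'i] := f'E _ Iai.
have t1 : ~~ (t i %| 1) by rewrite dvdn1; have := t_odd Ii; lia.
have [|bi ee] := @rotation_pow_eq i (beta (alpha i)) 1 (e' (alpha i) * e i) Ii Ibi _ t1.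
  by rewrite /= gmulx1 -[LHS]fK fi ghomX // f'i gpowM.
rewrite -bi; split=> //; rewrite -bi in f'i.
have : gpow (f' (rotation (alpha i))) (t (alpha i)) = gone W.
  by rewrite -ghomX // rotation_order // ghom1.
rewrite f'i -gpowM => /(rotation_pow_eq1 Ii).
by rewrite Gauss_dvdr // coprime_sym; exact: (inverse_exp_coprime (esym ee)).
Qed.

Lemma power_aut_congr f e e' : power_aut f e -> {in I, e =1 e'} -> power_aut f e'.
Proof. by case=> fM f1 fr ee; split=> // i Ii; rewrite -ee //; exact: fr. Qed.

(** * Generated subgroups; $C$ and $\langle\widehat{w_1}\rangle$ made explicit *)

Lemma aut_gen_subgroup (S : (W -> W) -> Prop) :
  (forall f, S f -> is_aut f) -> aut_subgroup (aut_gen S).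
Proof.
move=> Saut; split.
  move=> f Sf; apply: Sf => //; split=> //; split.
    move=> g h [gM [g' [gK g'K]]] gh; split=> [x y|]; first by rewrite -!gh gM.
    by exists g'; split=> x; rewrite -gh.
  split; first by split=> //; exists id.
  split=> [g h [gM [g' [gK g'K]]] [hM [h' [hK h'K]]]|g h [gM _] gK hK].
    split; first exact: ghom_comp.
    by exists (fun x => h' (g' x)); split=> x; rewrite ?gK ?hK ?h'K ?g'K.
  by split; [exact: (ghom_cancel gM) | exists g].
split; first by move=> f g Sf fg P HP SP; have [_ [H _]] := HP; apply: (H f) => //; exact: Sf.
split; first by move=> P [_ [_ []]].
split.
  move=> f g Sf Sg P HP SP; have [_ [_ [_ [H _]]]] := HP.
  by apply: H; [exact: Sf | exact: Sg].
move=> f g Sf fK gK P HP SP; have [_ [_ [_ [_ H]]]] := HP.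
by apply: (H f) => //; exact: Sf.
Qed.

Lemma power_aut_subgroup (R : (nat -> nat) -> Prop) :
  R (fun=> 1) ->
  (forall e e', R e -> R e' -> R (fun i => e i * e' i)) ->
  (forall e e', R e -> (forall i, I i -> e i * e' i = 1 %[mod t i]) -> R e') ->
  aut_subgroup (fun f => exists e, power_aut f e /\ R e).
Proof.
move=> R1 RM RV; split; first by move=> f [e [/power_aut_is_aut]].
split; first by move=> f g [e [fe Re]] fg; exists e; split=> //; exact: power_aut_feq fe fg.
split; first by exists (fun=> 1); split=> //; exact: power_aut_id.
split.
  move=> f g [e [fe Re]] [e' [ge Re']]; exists (fun i => e i * e' i).
  by split; [exact: power_aut_comp | exact: RM].
move=> f g [e [fe Re]] fK gK; have [h [e' [he hK _ ee']]] := power_aut_inverse fe.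
exists e'; split; last exact: (RV e).
by apply: (power_aut_feq he) => x; rewrite -{1}(gK x) hK.
Qed.

Lemma theta_power_aut f : theta_gen n m k w f -> exists e, power_aut f e.
Proof.
case=> i [e [Ii [et [ce [[fM _] [fw fi]]]]]].
have f1 : f (w 1) = w 1 by apply: fw; move: Ii => /=; lia.
exists (fun j => if j == i then e else 1); split=> // j Ij.
rewrite /rotation fM f1; case: eqP => [->|/eqP ji]; last first.
  by rewrite coprime1n fw //= ?gmulx1 //; move: Ij => /=; lia.
by rewrite fi w1K.
Qed.

Lemma Cgrp_subgroup : aut_subgroup (Cgrp n m k w).
Proof. by apply: aut_gen_subgroup => f /theta_power_aut [e /power_aut_is_aut]. Qed.

(** Induction over the truncations [T j], which keep the exponents up to index [j] and put 1
    elsewhere; each step composes with at most one generator of $C$. *)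
Lemma power_aut_Cgrp f e : power_aut f e -> Cgrp n m k w f.
Proof.
have [_ [Cfeq [C1 [CM _]]]] := Cgrp_subgroup.
pose T j i := if i <= j then e i else 1.
move=> fe; have ce i : I i -> coprime (e i) (t i) by case: fe => _ _ /(_ i) + Ii => /(_ Ii) [].
suff {f fe} H j : forall f, power_aut f (T j) -> Cgrp n m k w f.
  apply: (H n); apply: power_aut_congr fe _ => i.
  by rewrite /T inE => /andP [_ ->].
elim: j => [|j IH] f fT.
  apply: (Cfeq id) => // x; symmetry; move: x; apply: (power_aut_eq fT power_aut_id) => i.
  by rewrite /T /=; case: i.
have [Ij|Ij] := boolP (I j.+1); last first.
  apply: IH; apply: power_aut_congr fT _ => i Ii; rewrite /T [i <= j.+1]leq_eqVlt ltnS.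
  by case: eqP => // ij; case/negP: Ij; rewrite -ij.
have [g gT] : exists g, power_aut g (T j).
  by apply: power_aut_exists => i Ii; rewrite /T; case: ifP; rewrite ?coprime1n ?ce.
(* A generator of $C$ requires an exponent below [t i]. *)
pose e1 i := if i == j.+1 then e i %% t i else 1.
have [h he] : exists h, power_aut h e1.
  apply: power_aut_exists => i Ii; rewrite /e1; case: ifP; rewrite ?coprime1n // => _.
  by rewrite coprime_modl ce.
apply: (Cfeq (fun x => g (h x))).
  apply: CM; first exact: IH.
  move=> P _; apply; have [hM h1 hr] := he; have [cj rj] := hr _ Ij.
  have tj := t_odd Ij; rewrite /e1 eqxx in cj rj.
  exists j.+1, (e j.+1 %% t j.+1); split=> //; split; last split=> //.
    rewrite ltn_mod (exp_gt0 Ij) andbT lt0n; apply/eqP => E.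
    by move: cj; rewrite E /coprime gcd0n => /eqP; lia.
  split; first exact: power_aut_is_aut he.
  split; last by rewrite {1}w_rotation hM h1 rj.
  case=> [//|[//|i]] Ii ij; rewrite {1}w_rotation hM h1; have [_ ->] := hr i.+2 Ii.
  by rewrite /e1 (negbTE ij) /= gmulx1 -w_rotation.
apply: (power_aut_eq (power_aut_comp gT he) fT) => i Ii; rewrite /T /e1.
case: eqP => [->|/eqP ij]; first by rewrite ltnn leqnn mul1n modn_mod.
by rewrite muln1 [i <= j.+1]leq_eqVlt ltnS (negbTE ij).
Qed.

Lemma Cgrp_power_aut f : Cgrp n m k w f <-> exists e, power_aut f e.
Proof.
split=> [Cf|[e]]; last exact: power_aut_Cgrp.
have [] // : exists e, power_aut f e /\ True; last by move=> e []; exists e.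
apply: (Cf (fun f => exists e, power_aut f e /\ True)).
  exact: (@power_aut_subgroup (fun=> True)).
by move=> g /theta_power_aut [e ge]; exists e.
Qed.

Lemma hat_w1K : involutive (hat_w1 w).
Proof. by move=> x; rewrite /hat_w1 -!gmulA w1K w1_square gmulx1. Qed.

Lemma W1grp_subgroup : aut_subgroup (W1grp w).
Proof.
apply: aut_gen_subgroup => f fh.
apply: (@power_aut_is_aut _ (fun i => (t i).-1)).
by apply: (power_aut_feq power_aut_hat) => x; rewrite fh.
Qed.

Lemma W1grp_hat : W1grp w (hat_w1 w).
Proof. by move=> P _; apply. Qed.

(** As $\widehat{w_1}$ is an involution, it already forms a subgroup together with the identity. *)
Lemma W1grp_cases f : W1grp w f -> f =1 id \/ f =1 hat_w1 w.
Proof.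
move=> Wf; apply: (Wf (fun f => f =1 id \/ f =1 hat_w1 w)) => [|g]; last by right.
split.
  move=> g [] gE.
    by apply: (power_aut_is_aut (power_aut_feq power_aut_id _)) => x; rewrite gE.
  by apply: (power_aut_is_aut (power_aut_feq power_aut_hat _)) => x; rewrite gE.
split; first by move=> g h [] gE gh; [left|right] => x; rewrite -gh gE.
split; first by left.
split.
  move=> g h [] gE [] hE; [left|right|right|left] => x; rewrite gE hE //.
  exact: hat_w1K.
by move=> g h [] gE gK hK; [left|right] => x; rewrite -{2}(hK x) gE ?hat_w1K.
Qed.

Lemma graph_hom_exists alpha :
  (forall i, I i -> I (alpha i) /\ t (alpha i) = t i) ->
  exists g : W -> W, [/\ ghom g, g (w 1) = w 1
    & forall i, I i -> g (w i) = w (alpha i)].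
Proof.
move=> aI; pose h j := if j == 1 then w 1 else w (alpha j).
have hI i : I i -> h i = w (alpha i) by case: i => [|[]].
have rel : star_rel n m k h.
  split=> [[//|[|i]] Ii|i Ii]; first exact: w1_square.
    by rewrite hI //; apply: w_square; case: (aI i.+2 Ii).
  by rewrite (hI i) //; have [Iai <-] := aI _ Ii; exact: rotation_order.
have [g [gM gw]] := star_hom_exists rel; exists g; split=> //; first exact: gw.
by move=> i Ii; rewrite gw ?hI //; move: Ii => /=; lia.
Qed.

Lemma block_perm_exp alpha i : block_perm n k alpha -> I i -> t (alpha i) = t i.
Proof.
case=> _ [_ aB] Ii; rewrite /Defs.tval; apply: eq_bigl => j; exact: aB.
Qed.

(** * The complement $D$, cut out by a quadratic residue condition *)

Section Complement.
Variables (p i0 : nat).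
Hypotheses (p_prime : prime p) (p_mod4 : p %% 4 = 3) (Ii0 : I i0) (p_dvd : p %| t i0).
Hypothesis i0_fixed : forall alpha, block_perm n k alpha -> alpha i0 = i0.
Hypothesis exp_block : forall i j, I i -> I j -> t i = t j ->
  forall r, inBlock k r i = inBlock k r j.

(* Euler's criterion: [residue a] says that [a] is a nonzero square mod [p]. *)
Definition residue a := a ^ p./2 == 1 %[mod p].

Definition Dgrp (f : W -> W) := exists e, power_aut f e /\ residue (e i0).

Lemma residueM a b : residue a -> residue b -> residue (a * b).
Proof.
rewrite /residue expnMn => /eqP aE /eqP bE.
by rewrite -modnMm aE bE modnMm.
Qed.

Lemma residue_mod a b : a = b %[mod t i0] -> residue a -> residue b.
Proof.
move=> ab; rewrite /residue; suff -> : a ^ p./2 = b ^ p./2 %[mod p] by [].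
rewrite -modnXm -[RHS]modnXm; congr (_ ^ _ %% _).
by rewrite -(modn_dvdm a p_dvd) ab modn_dvdm.
Qed.

Lemma residue1 : residue 1.
Proof. by rewrite /residue exp1n. Qed.

Lemma residue_inv a b : a * b = 1 %[mod t i0] -> residue a -> residue b.
Proof.
move=> /esym/residue_mod/(_ residue1); rewrite /residue expnMn => /eqP abE /eqP aE.
by apply/eqP; rewrite -abE -modnMml aE modnMml mul1n.
Qed.

(** Since $p\equiv3\pmod 4$, [p./2] is odd, and an odd power of $t_{i_0}-1$ is $-1$ modulo
    $t_{i_0}$. *)
Lemma minus1_half_power : p %| ((t i0).-1 ^ p./2).+1.
Proof.
have ti := exp_gt0 Ii0; have odd_h : odd p./2 by lia.
apply: dvdn_trans p_dvd _; rewrite -[p./2]odd_double_half odd_h -muln2 expnD expn1.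
elim: (p./2)./2 => [|r IH]; first by rewrite mul0n expn0 muln1 prednK.
rewrite mulSn expnD; set u := (t i0).-1 ^ (r * 2) in IH *.
(* A subtraction-free use of $(t-1)^2+2t=t^2+1$. *)
have E : ((t i0).-1 * ((t i0).-1 ^ 2 * u)).+1 + t i0 * ((t i0).-1 * u) * 2
    = ((t i0).-1 * u).+1 + t i0 * (t i0 * ((t i0).-1 * u)).
  by rewrite -(prednK ti); set s := (t i0).-1; nia.
rewrite -(dvdn_addl _ (n := t i0 * ((t i0).-1 * u) * 2)).
  by rewrite E dvdn_addl // dvdn_mulr.
by rewrite -mulnA dvdn_mulr.
Qed.

Lemma minus1_nonresidue : ~~ residue (t i0).-1.
Proof.
rewrite /residue; apply/negP => /eqP E.
have := minus1_half_power; rewrite /dvdn -addn1 -modnDml E modnDml.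
by rewrite modn_small //; have := prime_gt1 p_prime; lia.
Qed.

(** With $u=a^{(p-1)/2}$, Fermat gives $p\mid a(u-1)(u+1)$, so $u\equiv\pm1$; a factor $-1$ corrects
    the sign. *)
Lemma residue_dichotomy a : coprime a p -> residue a \/ residue (a * (t i0).-1).
Proof.
move=> ap; have p1 := prime_gt1 p_prime; have a0 : 0 < a.
  by case: a ap => //; rewrite /coprime gcd0n; lia.
have pE : p = (p./2 + p./2).+1 by lia.
have u0 : 0 < a ^ p./2 by rewrite expn_gt0 a0.
have : p %| a ^ p - a.
  by rewrite -eqn_mod_dvd ?fermat_little // -{1}[a]expn1 leq_pexp2l //; lia.
set u := a ^ p./2 in u0 *.
have -> : a ^ p - a = a * ((u - 1) * u.+1).
  by rewrite {1}pE expnS expnD -/u -[X in _ - X]muln1 -mulnBr; congr (_ * _); nia.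
rewrite Gauss_dvdr 1?coprime_sym //.
rewrite Euclid_dvdM // => /orP [H|H].
  by left; rewrite /residue eqn_mod_dvd.
right; rewrite /residue expnMn -/u; have := minus1_half_power.
set v := (t i0).-1 ^ _ => Hv; apply/eqP.
have E : u * v + u.+1 + v.+1 = u.+1 * v.+1 + 1 by nia.
move: (congr1 (modn^~ p) E).
case/dvdnP: H => u' ->; case/dvdnP: Hv => v' ->.
by rewrite -addnA -mulnDl [u * v + _]addnC mulnA !modnMDl.
Qed.

Lemma Dgrp_subgroup : aut_subgroup Dgrp.
Proof.
apply: (@power_aut_subgroup (fun e => residue (e i0))) => [|e e'|e e' re ee'].
- exact: residue1.
- exact: residueM.
- exact: residue_inv (ee' i0 Ii0) re.
Qed.

(** Exponents are unique modulo [t i0], a multiple of [p], so membership in $D$ can be tested on any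
    choice of them. *)
Lemma Dgrp_exp f e : Dgrp f -> power_aut f e -> residue (e i0).
Proof.
by case=> e' [fe' re'] fe; exact: residue_mod (power_aut_exp fe' fe Ii0) re'.
Qed.

(** If the exponent at [i0] is not a residue, composing with $\widehat{w_1}$ makes it one. *)
Lemma power_aut_split f e : power_aut f e -> exists d eps,
  Dgrp d /\ forall x, f x = d (w1_pow eps ** x ** ginv (w1_pow eps)).
Proof.
move=> fe; have [|re|re] := @residue_dichotomy (e i0).
- case: fe => _ _ /(_ _ Ii0) [ce _]; exact: coprime_dvdr p_dvd ce.
- by exists f, false; split=> [|x]; [exists e | rewrite /= gmul1 ginv1 gmulx1].
exists (fun x => f (hat_w1 w x)), true; split.
  by exists (fun i => e i * (t i).-1); split=> //; exact: power_aut_comp power_aut_hat.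
by move=> x; rewrite /= w1V -/(hat_w1 w x) hat_w1K.
Qed.

Lemma Dgrp_sub_Cgrp f : Dgrp f -> Cgrp n m k w f.
Proof. by case=> e [fe _]; exact: power_aut_Cgrp fe. Qed.

Lemma Dgrp_hat f : Dgrp f -> ~ f =1 hat_w1 w.
Proof.
move=> Df fh; have fe : power_aut f (fun i => (t i).-1).
  by apply: (power_aut_feq power_aut_hat) => x; rewrite fh.
by have := Dgrp_exp Df fe; exact/negP/minus1_nonresidue.
Qed.

Lemma Dgrp_W1grp f : Dgrp f -> W1grp w f -> feq f id.
Proof. by move=> Df /W1grp_cases [] // /(Dgrp_hat Df). Qed.

Lemma Cgrp_decomposition f : Cgrp n m k w f <->
  exists d c, [/\ Dgrp d, W1grp w c & feq f (fun x => d (c x))].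
Proof.
have [_ [_ [W11 _]]] := W1grp_subgroup.
split=> [/Cgrp_power_aut [e /power_aut_split [d [eps [Dd fd]]]]|].
  case: eps fd => fd.
    exists d, (hat_w1 w); split=> // [|x]; first exact: W1grp_hat.
    by rewrite fd /= w1V.
  by exists d, id; split=> // x; rewrite fd /= gmul1 ginv1 gmulx1.
case=> d [c [[e [de _]] Wc fdc]]; apply/Cgrp_power_aut.
have [e' ce] : exists e', power_aut c e'.
  case: (W1grp_cases Wc) => cE; [exists (fun=> 1)|exists (fun i => (t i).-1)].
    by apply: (power_aut_feq power_aut_id) => x; rewrite cE.
  by apply: (power_aut_feq power_aut_hat) => x; rewrite cE.
exists (fun i => e i * e' i); apply: (power_aut_feq (power_aut_comp de ce)) => x.
by rewrite fdc.
Qed.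

(** Conjugation by [g] permutes the exponents along [alpha] and leaves the one at [i0] in place. *)
Lemma Dgrp_normalised g g' d : Ggrp n k w g -> cancel g' g -> cancel g g' ->
  Dgrp d -> Dgrp (fun x => g (d (g' x))).
Proof.
case=> [[gM _] [alpha [aB [g1 gw]]]] g'K gK [e [[dM d1 dr] re]].
have gr i : I i -> g (rotation i) = rotation (alpha i).
  by move=> Ii; rewrite gM g1 gw.
have g'M : ghom g' by exact: (ghom_cancel gM).
have g'1 : g' (w 1) = w 1 by rewrite -{1}g1 gK.
have aI i : I i -> I (alpha i) by case: aB => + _; exact.
have [beta [e' g'r]] : exists beta e', forall i, I i ->
    I (beta i) /\ g' (rotation i) = gpow (rotation (beta i)) (e' i).
  by apply: aut_rotation => //; split=> //; exists g.
have grX i : I i -> I (alpha i) /\ g (rotation i) = gpow (rotation (alpha i)) 1.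
  by move=> Ii; rewrite gr //= gmulx1; split=> //; exact: aI.
have ab i (Ii : I i) := aut_rotation_inverse gM g'K g'r grX Ii.
exists (fun i => e (beta i)); split; last first.
  suff -> : beta i0 = i0 by [].
  case: aB (aB) => _ [a_inj _] aB; apply: a_inj => //; first by case: (g'r _ Ii0).
  by have [-> _ _] := ab _ Ii0; rewrite i0_fixed.
split=> [x y||i Ii]; first by rewrite g'M dM gM.
  by rewrite g'1 d1.
have [abi _ _] := ab i Ii; have [Ibi _] := g'r i Ii.
have [ce dE] := dr _ Ibi; split.
  by rewrite -[X in t X]abi (block_perm_exp aB).
by rewrite -{1}abi -gr // gK dE ghomX // gr // abi.
Qed.

(** $b_i$ goes both to a power of itself and to $b_{\alpha(i)}$, so $\alpha(i)=i$. *)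
Lemma Dgrp_Ggrp f : Dgrp f -> Ggrp n k w f -> feq f id.
Proof.
case=> [e [[fM f1 fr] _]] [_ [alpha [[aI _] [_ fw]]]].
apply: star_hom_eq => // i Ii.
have fri : f (rotation i) = rotation (alpha i) by rewrite fM f1 fw.
have [||] := @rotation_pow_eq (alpha i) i 1 (e i) (aI i Ii) Ii.
- by have [_ <-] := fr i Ii; rewrite fri /= gmulx1.
- by rewrite dvdn1; have := t_odd (aI i Ii); lia.
by move=> ai _; rewrite fri ai.
Qed.

(** The product fixes $w_1$, so the conjugating element is 1 or $w_1$. As [g] fixes $b_{i_0}$, the
    latter would give [d] the exponent $-1$ at [i0], a nonresidue. *)
Lemma Dgrp_Ggrp_inner d g : Dgrp d -> Ggrp n k w g -> is_inn (fun x => d (g x)) ->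
  feq (fun x => d (g x)) id.
Proof.
case=> e [[dM d1 dr] re] [[gM _] [alpha [aB [g1 gw]]]] [a dga].
have [eps aE] : exists eps, a = w1_pow eps.
  apply: w1_centraliser; have := dga (w 1); rewrite g1 d1 => {2}->.
  by rewrite -gmulA gmulV gmulx1.
case: eps aE => aE x; last by rewrite dga aE /= gmul1 ginv1 gmulx1.
have := dga (rotation i0); rewrite gM g1 gw // (i0_fixed aB) aE /= w1V.
have [_ hE] := (let: And3 _ _ H := power_aut_hat in H) i0 Ii0.
have [_ dE] := dr _ Ii0; rewrite -/(rotation i0) dE -/(hat_w1 w _) hE.
move/(rotation_pow_inj Ii0)/residue_mod/(_ re) => H.
by have := minus1_nonresidue; rewrite H.
Qed.

Lemma aut_decomposition f : is_aut f -> exists d g a,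
  [/\ Dgrp d, Ggrp n k w g, is_inn a & feq f (fun x => d (g (a x)))].
Proof.
case=> fM [f' [fK f'K]].
have w1N1 : w 1 <> gone W.
  have [d [dM d1 _]] := parity_exists => E.
  by have := dM (gone W) (gone W); rewrite gmul1 -E d1.
have [v vE] : exists v, f (w 1) = v ** w 1 ** ginv v.
  case: (@involution_conj (f (w 1))) => [|f1|//].
    by rewrite -fM w1_square ghom1.
  by case: w1N1; rewrite -[LHS]fK f1 -{1}(ghom1 fM) fK.
(* An inner correction makes $w_1$ fixed. *)
pose f1 x := ginv v ** f x ** v; pose f1' x := f' (v ** x ** ginv v).
have f1K : cancel f1 f1'.
  by move=> x; rewrite /f1 /f1' -!gmulA gmulVK gmulxV gmulx1 fK.
have f1'K : cancel f1' f1.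
  by move=> x; rewrite /f1 /f1' f'K -!gmulA gmulK gmulV gmulx1.
have f1M : ghom f1 by move=> x y; rewrite /f1 fM -!gmulA gmulVK.
have f1'M := ghom_cancel f1M f1K f1'K.
have f11 : f1 (w 1) = w 1 by rewrite /f1 vE -!gmulA gmulK gmulV gmulx1.
have f1'1 : f1' (w 1) = w 1 by rewrite -{1}f11 f1K.
have [|alpha [e fE]] := aut_rotation _ f11; first by split=> //; exists f1'.
have [|beta [e' f'E]] := aut_rotation _ f1'1; first by split=> //; exists f1.
have ba i (Ii : I i) := aut_rotation_inverse f1'M f1K fE f'E Ii.
have ab i (Ii : I i) := aut_rotation_inverse f1M f1'K f'E fE Ii.
have aI i : I i -> I (alpha i) by move=> /fE [].
have bI i : I i -> I (beta i) by move=> /f'E [].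
(* The two orders divide each other. *)
have ta i : I i -> t (alpha i) = t i.
  move=> Ii; have [bai _ d1] := ba i Ii; have [_ _] := ab _ (aI i Ii).
  by rewrite bai => d2; apply/eqP; rewrite eqn_dvd d1 d2.
have tb i : I i -> t (beta i) = t i.
  by move=> Ii; have [abi _ _] := ab i Ii; rewrite -{2}abi ta //; exact: bI.
have [g [gM g1 gw]] : exists g : W -> W, [/\ ghom g, g (w 1) = w 1
    & forall i, I i -> g (w i) = w (alpha i)].
  by apply: graph_hom_exists => i Ii; split; [exact: aI | exact: ta].
have [g' [g'M g'1 g'w]] : exists g : W -> W, [/\ ghom g, g (w 1) = w 1
    & forall i, I i -> g (w i) = w (beta i)].
  by apply: graph_hom_exists => i Ii; split; [exact: bI | exact: tb].
have gr i : I i -> g (rotation i) = rotation (alpha i) by move=> Ii; rewrite gM g1 gw.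
have g'r i : I i -> g' (rotation i) = rotation (beta i).
  by move=> Ii; rewrite g'M g'1 g'w.
have gK : cancel g g'.
  apply: (star_hom_eq (ghom_comp g'M gM)) => //= [|i Ii]; first by rewrite g1.
  by have [bai _ _] := ba i Ii; rewrite gr // g'r ?bai //; exact: aI.
have g'K : cancel g' g.
  apply: (star_hom_eq (ghom_comp gM g'M)) => //= [|i Ii]; first by rewrite g'1.
  by have [abi _ _] := ab i Ii; rewrite g'r // gr ?abi //; exact: bI.
have gG : Ggrp n k w g.
  split; first by split=> //; exists g'.
  exists alpha; split; last by [].
  split; first exact: aI.
  split=> [i j Ii Ij aij|i r Ii]; last by apply: exp_block; [exact: aI| |exact: ta].
  by have [<- _ _] := ba i Ii; have [<- _ _] := ba j Ij; rewrite aij.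
(* Once the graph part is removed, every rotation goes to a power of itself. *)
have [|d [eps [Dd fd]]] := @power_aut_split (fun x => f1 (g' x)) (fun i => e (beta i)).
  split; first exact: ghom_comp.
    by rewrite g'1.
  move=> i Ii; have [abi _ _] := ab i Ii; have [_ ee _] := ba _ (bI i Ii).
  split; first by apply: (@inverse_exp_coprime _ (e' i)); rewrite -(tb i Ii) mulnC -{1}abi.
  by rewrite g'r //; have [_ ->] := fE _ (bI i Ii); rewrite abi.
have [dM [d' [dK d'K]]] : is_aut d by case: Dgrp_subgroup => H _; exact: H.
have gs : g (w1_pow eps) = w1_pow eps by case: (eps); rewrite /= ?ghom1.
(* The inner factor acts first, so [v] is pulled back through [d] and [g]; [w1_pow eps] comes from
   splitting $C$. *)
pose u := g' (d' v) ** w1_pow eps.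
exists d, g, (fun x => u ** x ** ginv u); split=> //; first by exists u.
move=> x; have -> : f x = v ** f1 (g' (g x)) ** ginv v.
  by rewrite gK /f1 -!gmulA gmulVK gmulxV gmulx1.
have du : d (g u) = v ** d (w1_pow eps) by rewrite /u gM g'K gs dM d'K.
rewrite fd (gM (u ** x)) (gM u) (ghomV gM) !dM !(ghomV dM) du ginvM.
by rewrite !gmulA.
Qed.

End Complement.

End StarGroup.

(** * Blocks, exponents and the final assembly *)

Lemma block_start_le (k : seq nat) i j : i < j ->
  \sum_(r < i.+1) nth 0 k r <= \sum_(r < j) nth 0 k r.
Proof. by move=> ij; rewrite -(subnKC ij) big_split_ord leq_addr. Qed.

Lemma inBlock_unique (k : seq nat) i j j' : inBlock k j i -> inBlock k j' i -> j = j'.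
Proof.
rewrite /inBlock => /andP [lo hi] /andP [lo' hi'].
by case: (ltngtP j j') => // jj; have := block_start_le k jj; lia.
Qed.

Lemma inBlock_exists (k : seq nat) N i :
  2 <= i < 2 + \sum_(r < N) nth 0 k r -> exists2 j, j < N & inBlock k j i.
Proof.
elim: N => [|N IH]; first by rewrite big_ord0; lia.
case: (ltnP i (2 + \sum_(r < N) nth 0 k r)) => [lt|ge] /andP [i2 hi].
  have [|j jN ji] := IH; first by rewrite i2.
  by exists j => //; exact: ltnW.
by exists N => //; rewrite /inBlock ge.
Qed.

(** Blocks are disjoint, so the sum defining [tval] has only the term [j]. *)
Lemma tval_inBlock (m k : seq nat) i j :
  j < size m -> inBlock k j i -> Defs.tval m k i = nth 0 m j.
Proof.
move=> jm ji; rewrite /Defs.tval (bigD1 (Ordinal jm)) //= big1 ?addn0 //.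
move=> r /andP [ri /eqP []]; apply: val_inj => /=; exact: inBlock_unique ri ji.
Qed.

Theorem theorem4p5 (n : nat) (m k : seq nat) (W : grp) (w : nat -> W) :
  3 <= n ->
  uniq m -> all (fun x => odd x && (3 <= x)) m ->
  size k = size m -> all (fun x => 0 < x) k ->
  \sum_(r < size k) nth 0 k r = n - 1 ->
  is_star_group n m k w ->
  (exists i p, [/\ i < size m, nth 0 k i = 1, prime p, p %% 4 = 3
                 & p %| nth 0 m i]) ->
  exists D : (W -> W) -> Prop,
    (* D is a subgroup of Aut(W) *)
    aut_subgroup D /\
    (* D <= C *)
    (forall f, D f -> Cgrp n m k w f) /\
    (* D cap <hat w1> = 1 *)
    (forall f, D f -> W1grp w f -> feq f id) /\
    (* C = D <hat w1> *)
    (forall f, Cgrp n m k w f <->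
       exists d c, [/\ D d, W1grp w c & feq f (fun x => d (c x))]) /\
    (* G normalises D *)
    (forall g g' d, Ggrp n k w g -> (forall x, g (g' x) = x) ->
       (forall x, g' (g x) = x) -> D d -> D (fun x => g (d (g' x)))) /\
    (* D cap G = 1 (so DG is the internal semidirect product of D by G) *)
    (forall f, D f -> Ggrp n k w f -> feq f id) /\
    (* DG cap Inn(W) = 1 *)
    (forall d g, D d -> Ggrp n k w g -> is_inn (fun x => d (g x)) ->
       feq (fun x => d (g x)) id) /\
    (* Aut(W) = DG Inn(W) *)
    (forall f, is_aut f -> exists d g a,
       [/\ D d, Ggrp n k w g, is_inn a & feq f (fun x => d (g (a x)))]).
Proof.
move=> n3 um modd km _ ksum starW [j0 [p [j0m kj0 pp p4 pm]]].
pose I := [pred i | 2 <= i <= n].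
have blk i : I i -> exists2 j, j < size m & inBlock k j i.
  by move=> Ii; rewrite -km; apply: inBlock_exists; rewrite ksum; move: Ii => /=; lia.
have t_odd i : I i -> odd (Defs.tval m k i) && (2 < Defs.tval m k i).
  by move=> /blk [j jm ji]; rewrite (tval_inBlock jm ji); exact: (allP modd) (mem_nth 0 jm).
have n0 : 0 < n by exact: leq_trans n3.
(* A block of size 1 consists of its first index. *)
pose i0 := 2 + \sum_(r < j0) nth 0 k r.
have i0j0 i : inBlock k j0 i = (i == i0).
  by rewrite /inBlock big_ord_recr /= kj0 -/i0 addnA addn1 ltnS -/i0 eqn_leq andbC.
have Ii0 : I i0.
  rewrite -km in j0m; have := block_start_le k j0m.
  by rewrite big_ord_recr /= kj0 ksum /I /i0 /=; lia.
have i0E : inBlock k j0 i0 by rewrite i0j0.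
have fixed alpha : block_perm n k alpha -> alpha i0 = i0.
  by case=> _ [_ aB]; apply/eqP; rewrite -i0j0 aB.
(* The entries of [m] are distinct, so the exponent determines the block. *)
have same i j : I i -> I j -> Defs.tval m k i = Defs.tval m k j ->
    forall r, inBlock k r i = inBlock k r j.
  move=> /blk [a am ai] /blk [b bm bj]; rewrite (tval_inBlock am ai) (tval_inBlock bm bj).
  move/eqP; rewrite nth_uniq // => /eqP ab r; rewrite -ab in bj.
  by apply/idP/idP => H; [rewrite (inBlock_unique H ai) | rewrite (inBlock_unique H bj)].
rewrite -(tval_inBlock j0m i0E) in pm.
exists (Dgrp n m k w p i0).
split; first exact: Dgrp_subgroup.
split; first exact: Dgrp_sub_Cgrp.
split; first exact: Dgrp_W1grp.
split; first exact: Cgrp_decomposition.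
split; first exact: Dgrp_normalised.
split; first exact: Dgrp_Ggrp.
split; first exact: Dgrp_Ggrp_inner.
exact: aut_decomposition.
Qed.
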